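(* Let $p$ be a prime and let $G=D_{2p^2}$. Then $$\mathrm{Spec}(\mathcal{B}(G))=\Big\{(0)^{4p^4-p^2-p-4}, (-1)^1, (1)^1, (\sqrt{3})^{p^2}, (-\sqrt{3})^{p^2}, (\sqrt{p^2-1})^1, (-\sqrt{p^2-1})^1, (\sqrt{p^4-p^2})^1, (-\sqrt{p^4-p^2})^1,$$ $$\qquad (\sqrt{3p^2-3p})^p, (-\sqrt{3p^2-3p})^p, (\sqrt{3p^4-3p^3})^1, (-\sqrt{3p^4-3p^3})^1\Big\},$$ $$\mathrm{L\text{-}spec}(\mathcal{B}(G))=\Big\{(0)^{p^2+p+4}, (1)^{4p^4-p^2-p-4}, (2)^1, (4)^{p^2}, (p^2)^1, (p^4-p^2+1)^1, (3p^2-3p+1)^{p}, (3p^4-3p^3+1)^{1}\Big\}=\mathrm{Q\text{-}spec}(\mathcal{B}(G)),$$ and $$\mathrm{CN\text{-}spec}(\mathcal{B}(G))=\Big\{(0)^{p^2+p+5}, (-1)^{4p^4-p^2-p-4}, (2)^{p^2}, (p^2-2)^1, (p^4-p^2-1)^1, (3p^2-3p-1)^p, (3p^4-3p^3-1)^1\Big\}.$$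
   Context: $D_{2m}=\langle a,b : a^m=b^2=1,\ bab=a^{-1}\rangle$ is the dihedral group of order $2m$. For a finite group $G$, let $L(G)$ be the set of all subgroups of $G$. The subgroup generating bipartite graph $\mathcal{B}(G)$ is the simple bipartite graph with vertex set the disjoint union of $G\times G$ and $L(G)$, in which $(a,b)\in G\times G$ and $H\in L(G)$ are adjacent if and only if $H$ is the subgroup generated by $a$ and $b$ (and there are no other edges). For a finite simple graph $\Gamma$ with vertices $v_1,\dots,v_n$, let $A$ be its adjacency matrix and $D$ its diagonal degree matrix. $\mathrm{Spec}(\Gamma)$, $\mathrm{L\text{-}spec}(\Gamma)$ and $\mathrm{Q\text{-}spec}(\Gamma)$ denote the multisets of eigenvalues (with multiplicity) of $A$, $D-A$ and $D+A$ respectively. The common neighborhood matrix $CN(\Gamma)$ has $(i,j)$ entry, for $i\ne j$, equal to the number of vertices other than $v_i,v_j$ adjacent to both $v_i$ and $v_j$, and zero diagonal; $\mathrm{CN\text{-}spec}(\Gamma)$ is the multiset of its eigenvalues. The notation $\{(x_1)^{n_1},\dots,(x_k)^{n_k}\}$ denotes the multiset in which $x_i$ is listed $n_i$ times; if some $x_i$ coincide for a particular $p$, their multiplicities are added. *)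

(* Defs.v *)
From mathcomp Require Import all_boot all_order all_algebra all_fingroup.

Set Implicit Arguments.
Unset Strict Implicit.
Unset Printing Implicit Defensive.

Import GRing.Theory Num.Theory.

Record sgraph := SGraph {
  svertex :> finType;
  sedge : rel svertex;
  sedge_sym : symmetric sedge;
  sedge_irr : irreflexive sedge }.

(** The vertices of a graph are listed by [enum_val : 'I_#|Gamma| -> Gamma]. *)
Section GraphMatrices.
Local Open Scope ring_scope.
Variables (C : numClosedFieldType) (Gamma : sgraph).

Definition adj_mx : 'M[C]_#|Gamma| :=
  \matrix_(i, j) (sedge (enum_val i) (enum_val j))%:R.

Definition deg (v : Gamma) : nat := #|[set w | sedge v w]|.

Definition deg_mx : 'M[C]_#|Gamma| := diag_mx (\row_i (deg (enum_val i))%:R).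

Definition laplacian_mx : 'M[C]_#|Gamma| := deg_mx - adj_mx.

Definition signless_laplacian_mx : 'M[C]_#|Gamma| := deg_mx + adj_mx.

Definition common_neighbors (v w : Gamma) : {set Gamma} :=
  [set u | [&& u != v, u != w, sedge v u & sedge w u]].

Definition cn_mx : 'M[C]_#|Gamma| :=
  \matrix_(i, j) (if i == j then 0
                  else #|common_neighbors (enum_val i) (enum_val j)|%:R).

End GraphMatrices.

(** The eigenvalues in [C] of a square matrix, each repeated according to its
    multiplicity as a root of the characteristic polynomial.  The order of the
    sequence is arbitrary: it is only meaningful up to [perm_eq]. *)
Definition eigenvalues (C : numClosedFieldType) n (A : 'M[C]_n) : seq C :=
  sval (closed_field_poly_normal (char_poly A)).

Definition spec (C : numClosedFieldType) (Gamma : sgraph) : seq C :=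
  eigenvalues (adj_mx C Gamma).
Definition L_spec (C : numClosedFieldType) (Gamma : sgraph) : seq C :=
  eigenvalues (laplacian_mx C Gamma).
Definition Q_spec (C : numClosedFieldType) (Gamma : sgraph) : seq C :=
  eigenvalues (signless_laplacian_mx C Gamma).
Definition CN_spec (C : numClosedFieldType) (Gamma : sgraph) : seq C :=
  eigenvalues (cn_mx C Gamma).

(** The group is the whole type [gT], so [L(G)] is the type [{group gT}] and the
    vertex set [(G * G) + L(G)] is a sum type. *)
Section SubgroupGeneratingBipartiteGraph.
Local Open Scope group_scope.
Variable gT : finGroupType.

Definition sgb_edge : rel (gT * gT + {group gT})%type := fun u v =>
  match u, v with
  | inl (a, b), inr H | inr H, inl (a, b) => <<[set a; b]>> == H :> {set gT}
  | _, _ => false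
  end.

Lemma sgb_edge_sym : symmetric sgb_edge.
Proof. by move=> [[a b]|H] [[c d]|K]. Qed.

Lemma sgb_edge_irr : irreflexive sgb_edge.
Proof. by move=> [[a b]|H]. Qed.

Definition sgb_graph : sgraph := SGraph sgb_edge_sym sgb_edge_irr.

End SubgroupGeneratingBipartiteGraph.

(** [gT] is the dihedral group of order [2 * m], given by its presentation.
    [\isog Grp] means isomorphic to the largest finite quotient of the presented
    group, which for [0 < m] is that group itself, as it is finite. *)
Definition is_dihedral (m : nat) (gT : finGroupType) : Prop :=
  ([set: gT] \isog Grp (a : b : a ^+ m, b ^+ 2, b * a * b = a^-1))%g.

(* Main.v *)
Require Import Defs.
From mathcomp Require Import all_boot all_order all_algebra all_fingroup.
From mathcomp Require Import all_solvable.
From mathcomp Require Import zify ring.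
Set Implicit Arguments.
Unset Strict Implicit.
Unset Printing Implicit Defensive.
Import GRing.Theory Num.Theory.

(** Every pair [(a, b)] has exactly one neighbour in the subgroup generating
    bipartite graph, the subgroup that it generates.  The graph is therefore a
    disjoint union of stars, one for each subgroup [H], and the number [n] of
    leaves of the star of [H] is the number of pairs that generate [H].  All
    four spectra are determined by the multiset of these [n].

    Spectra of a star forest.  Let [B] be the incidence matrix between the
    leaves [T] and the centers [U], so that [B^T *m B] is diagonal with entries
    [n].  One Schur complement evaluates every determinant that occurs:
    [det [y, cB; cB^T, diag w]] with [c ^ 2 = 1], multiplied by [y ^ #|U|], is
    [y ^ #|T|] times the product of the [y * w - n] ([det_star_blocks]).
    With [y = X - a] this gives the characteristic polynomials of [A], [D - A]
    and [D + A] ([char_poly_star]); the common neighborhood matrix, which is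
    [B *m B^T - 1] on the leaves and zero elsewhere, follows from the case
    [y = X + 1], [w = 1] ([char_poly_star_cn]).  Since the factor [y ^ #|U|] is
    kept on the left, the resulting equalities of multisets ([star_spec] and
    its analogues) hold without comparing [#|T|] and [#|U|].

    Counting generating pairs.  A dihedral group of order [2m] is used only
    through its rotation subgroup [A], which is cyclic of index 2 and has every
    element outside it squaring to 1 ([dihedral_presentation]).
    - A cyclic group of order [p ^ k.+1] has a unique maximal subgroup, and a
      pair generates unless both its components lie there
      ([card_gen_pairs_cyclic]).
    - If [H] is not contained in [A] and [d = #|H :&: A|], a rotation and a
      reflection generate [H] exactly when the rotation generates [H :&: A] and
      the reflection is one of the [d] reflections of [H].  The other two
      possible types of generating pairs reduce to this one by the bijections
      [(x, y) |-> (y, x)] and [(x, y) |-> (x * y, y)], whence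
      [3 * d * totient d] pairs ([card_gen_pairs_reflection]).
    - There is one subgroup of [A] of each order [d] dividing [m], and there are
      [m / d] subgroups outside [A] that meet [A] in order [d], because each of
      the [m] reflections lies in exactly one of them
      ([card_reflection_class]).
    For [m = p ^ 2] this yields the list of [gen_pairs_cards]. *)

(** * Generating pairs of cyclic groups *)

Section GeneratingPairs.
Local Open Scope group_scope.
Variable gT : finGroupType.
Implicit Types (x y : gT) (H K : {group gT}).

Definition gen_pairs H : {set gT * gT} :=
  [set xy | <<[set xy.1; xy.2]>>%G == H].

Lemma mem_gen_pairs H x y : ((x, y) \in gen_pairs H) = (<<[set x; y]>> == H).
Proof. by rewrite inE. Qed.

(** The subgroups of a cyclic group are ordered by inclusion as their orders are
    by divisibility, so every proper subgroup of [H] lies in [M]. *)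
Lemma card_gen_pairs_cyclic (A H M : {group gT}) p k : prime p -> cyclic A ->
    H \subset A -> M \subset A -> #|H| = (p ^ k.+1)%N -> #|M| = (p ^ k)%N ->
  #|gen_pairs H| = (p ^ (2 * k.+1) - p ^ (2 * k))%N.
Proof.
move=> p_pr cycA sHA sMA oH oM.
have sMH : M \subset H by rewrite -(cardSg_cyclic cycA) // oM oH dvdn_exp2l.
have -> : gen_pairs H = setX H H :\: setX M M.
  apply/setP => -[x y]; rewrite mem_gen_pairs !inE /=.
  have [/andP[xH yH]|nH] := boolP ((x \in H) && (y \in H)); last first.
    rewrite andbF; apply: contraNF nH => /eqP <-.
    by rewrite !mem_gen ?inE ?eqxx ?orbT.
  rewrite andbT; apply/eqP/idP => [defH | nM].
    apply/negP => /andP[xM yM].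
    have : H \subset M by rewrite -defH gen_subG subUset !sub1set xM.
    rewrite -(cardSg_cyclic cycA) // oM oH dvdn_Pexp2l ?prime_gt1 //.
    by rewrite ltnn.
  have sKH : <<[set x; y]>> \subset H by rewrite gen_subG subUset !sub1set xH.
  have sKA := subset_trans sKH sHA.
  apply/eqP; rewrite eqEcard sKH /=.
  have := cardSg sKH; rewrite oH => /(dvdn_pfactor _ _ p_pr)[i le_i oK].
  rewrite oK leq_exp2l ?prime_gt1 // leqNgt ltnS.
  apply: contra nM => le_ik.
  have /subsetP sKM : <<[set x; y]>> \subset M.
    by rewrite -(cardSg_cyclic cycA) //= oK oM dvdn_exp2l.
  by rewrite !sKM ?mem_gen ?inE ?eqxx ?orbT.
have sMMHH : setX M M \subset setX H H by rewrite setXS.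
by rewrite cardsD (setIidPr sMMHH) !cardsX oH oM -!expnD !mul2n -!addnn.
Qed.

Lemma card_gen_pairs1 : #|gen_pairs 1| = 1%N.
Proof.
rewrite -(cards1 (1 : gT * gT)); apply: eq_card => -[x y].
rewrite mem_gen_pairs inE xpair_eqE.
apply/eqP/andP => [E|[/eqP-> /eqP->]].
  by rewrite -!in_set1 -!set1gE -E !mem_gen ?inE ?eqxx ?orbT.
by rewrite setUid genGid.
Qed.

End GeneratingPairs.

(** * Subgroups of dihedral groups *)

(** The hypotheses force every element outside [A] to invert [A] by
    conjugation, so the group is dihedral with rotation subgroup [A]. *)
Section Dihedral.
Local Open Scope group_scope.
Variables (gT : finGroupType) (A : {group gT}).
Hypothesis cycA : cyclic A.
Hypothesis oG : #|gT| = (2 * #|A|)%N.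
Hypothesis refl2 : forall r, r \notin A -> r * r = 1.
Implicit Types (x y r : gT) (H K : {group gT}).

(* The cosets [A] and [A :* y^-1] fill the group, as [A] has index 2. *)
Let mul_out x y : x \notin A -> y \notin A -> x * y \in A.
Proof.
move=> xA yA; suff defCA : A :* y^-1 = ~: A.
  by rewrite -[y]invgK -mem_rcoset defCA inE.
apply/eqP; rewrite eqEcard card_rcoset cardsCs setCK oG mul2n -addnn addnK leqnn.
rewrite andbT; apply/subsetP => z; rewrite mem_rcoset invgK inE => zyA.
by apply: contra yA => zA; rewrite -(groupMl _ zA).
Qed.

(** Multiplying by [r] carries the elements of [H] outside [A] into
    [H :&: A]. *)
Lemma reflection_subset H K r :
  H :&: A \subset K -> r \in H -> r \in K -> r \notin A -> H \subset K.
Proof.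
move=> sHAK rH rK rA; apply/subsetP => h hH.
have [hA | hA] := boolP (h \in A); first by rewrite (subsetP sHAK) // inE hH.
rewrite -(groupMr _ rK) (subsetP sHAK) // inE groupM //=; exact: mul_out.
Qed.

Lemma reflection_eq H K r :
  H :&: A = K :&: A -> r \in H -> r \in K -> r \notin A -> H = K.
Proof.
move=> eqA rH rK rA; apply/eqP; rewrite -val_eqE eqEsubset /=; apply/andP; split.
  by apply: (reflection_subset _ rH rK rA); rewrite eqA subsetIl.
by apply: (reflection_subset _ rK rH rA); rewrite -eqA subsetIl.
Qed.

(** A reflection normalizes every cyclic group of rotations, so the subgroup
    generated is [<[x]> * <[r]>], in which [<[r]>] meets [A] trivially. *)
Lemma gen_rotation_reflection x r :
  x \in A -> r \notin A -> <<[set x; r]>> :&: A = <[x]>.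
Proof.
move=> xA rA; have rr := refl2 rA.
have r1 : r != 1 by apply: contraNneq rA => ->.
have or : #[r] = 2 by apply: nt_prime_order; rewrite // expgS expg1.
have xr : x ^ r = x^-1.
  (* [x * r] is a reflection too, so it squares to 1. *)
  have rV : r^-1 = r by apply/eqP; rewrite eq_invg_mul rr.
  have := @refl2 (x * r); rewrite groupMl // => /(_ rA) /eqP.
  by rewrite /conjg rV -mulgA -eq_invg_mul => /eqP->.
have nxr : <[r]> \subset 'N(<[x]>).
  by rewrite cycle_subG inE -cycleJ xr cycleV.
have -> : <<[set x; r]>> = <[x]> * <[r]>.
  by rewrite -norm_joinEr // /cycle joing_idl joing_idr.
rewrite -group_modl ?cycle_subG //.
have -> : <[r]> :&: A = 1.
  apply/trivgP/subsetP => z; rewrite in_setI /= cycle2g // !inE.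
  move=> /andP[/orP[|] /eqP-> //].
  by rewrite (negPf rA).
by rewrite mulg1.
Qed.

Lemma card_outside H : ~~ (H \subset A) -> #|H :\: A| = #|H :&: A|.
Proof.
case/subsetPn => r rH rA; rewrite -(card_rcoset (H :&: A) r).
apply: eq_card => z; rewrite mem_rcoset !inE groupMr ?groupV // andbC.
case: (z \in H) => //=; have [zA|zA] := boolP (z \in A).
  by rewrite groupMl // groupV (negPf rA).
by rewrite mul_out ?groupV.
Qed.

(** At least one component of a generating pair is a reflection.  The pairs
    with a rotation first and a reflection second form [Q]; the pairs of the
    opposite type are mapped to [Q] by [swap] and the pairs of reflections by
    [shear], neither of which changes the subgroup generated. *)
Lemma card_gen_pairs_reflection H : ~~ (H \subset A) ->
  #|gen_pairs H| = (3 * (#|H :&: A| * totient #|H :&: A|))%N.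
Proof.
move=> nHA.
pose Q := [set xy : gT * gT |
  [&& xy.1 \in A, xy.2 \notin A & <<[set xy.1; xy.2]>>%G == H]].
pose swap (xy : gT * gT) := (xy.2, xy.1).
pose shear (xy : gT * gT) := (xy.1 * xy.2, xy.2).
have cardQ : #|Q| = (#|H :&: A| * totient #|H :&: A|)%N.
  have [c defC] : exists c, H :&: A = <[c]>.
    by apply/cyclicP; apply: cyclicS cycA; apply: subsetIr.
  rewrite mulnC -[X in (_ * X)%N](card_outside nHA) defC -orderE totient_gen -cardsX.
  apply: eq_card => -[x y]; rewrite !inE /= /generator -defC.
  have [yA|yA] := boolP (y \in A); rewrite ?andbF //=.
  have [xA|xA] := boolP (x \in A); last first.
    apply/esym; apply: contraNF xA => /andP[/eqP E _].
    by have := cycle_id x; rewrite -E inE => /andP[].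
  rewrite /=; apply/eqP/andP => [<- | [/eqP E yH]].
    by rewrite /= gen_rotation_reflection // eqxx mem_gen // !inE eqxx orbT.
  apply: (@reflection_eq _ _ y) => //=; last by rewrite mem_gen // !inE eqxx orbT.
  by rewrite gen_rotation_reflection.
have swapI : injective swap by move=> [a b] [c d] [-> ->].
have shearI : injective shear by move=> [a b] [c d] [/[swap] -> /mulIg ->].
have -> : gen_pairs H = (Q :|: swap @^-1: Q) :|: shear @^-1: Q.
  apply/setP => -[x y]; rewrite !inE /=.
  have -> : <<[set y; x]>>%G = <<[set x; y]>>%G by rewrite setUC.
  have -> : <<[set (x * y)%g; y]>>%G = <<[set x; y]>>%G.
    apply/val_inj/eqP; rewrite /= eqEsubset !gen_subG !subUset !sub1set.
    have in1 u v : u \in <<[set u; v]>> by rewrite mem_gen ?inE ?eqxx.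
    have in2 u v : v \in <<[set u; v]>> by rewrite mem_gen ?inE ?eqxx ?orbT.
    rewrite groupM ?in1 ?in2 //= andbT.
    by rewrite -[X in X \in _](mulgK y x) groupM ?groupV ?in1 ?in2.
  case: eqP => [E|]; rewrite ?andbF // !andbT.
  have [xA|xA] := boolP (x \in A); have [yA|yA] := boolP (y \in A) => //=.
    case/negP: nHA; rewrite -E gen_subG subUset !sub1set xA; exact: yA.
  by rewrite mul_out.
have dis1 : Q :&: swap @^-1: Q = set0.
  apply/setP => -[x y]; rewrite !inE /=.
  by case: (x \in A); case: (y \in A); rewrite ?andbF.
have dis2 : (Q :|: swap @^-1: Q) :&: shear @^-1: Q = set0.
  apply/setP => -[x y]; rewrite !inE /=.
  have [xA|xA] := boolP (x \in A); have [yA|yA] := boolP (y \in A);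
    rewrite ?andbF //=.
  by rewrite groupMl // (negPf yA) andbF.
rewrite !cardsU dis1 dis2 cards0 !subn0 !card_preimset // cardQ.
by rewrite !mulSn mul0n addn0 addnA.
Qed.

(** Double counting of the incidences [r \in H] between reflections [r] and
    subgroups [H] of the class: [H] contains [d] reflections, and [r] lies in
    the single subgroup generated by [r] and the rotations of order dividing
    [d]. *)
Lemma card_reflection_class d : d %| #|A| ->
  (#|[set H : {group gT} | ~~ (H \subset A) & #|H :&: A| == d]| * d = #|A|)%N.
Proof.
move=> dvd_d; set S := [set H : {group gT} | _].
have oCA : #|~: A| = #|A| by rewrite cardsCs setCK oG mul2n -addnn addnK.
rewrite -[RHS]oCA -sum_nat_const -[RHS]sum1_card.
transitivity (\sum_(H in S) \sum_(r in ~: A | r \in H) 1)%N.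
  apply: eq_bigr => H; rewrite inE => /andP[nHA /eqP <-].
  rewrite -card_outside // -sum1_card; apply: eq_bigl => r.
  by rewrite !inE andbC.
rewrite (exchange_big_dep (mem (~: A))) /= => [|H r _ /andP[] //].
apply: eq_bigr => r rA; rewrite rA /= sum1dep_card.
rewrite inE in rA; case/cyclicP: cycA => a defA.
pose c := a ^+ (#|A| %/ d).
have cA : c \in A by rewrite defA mem_cycle.
have oc : #[c] = d.
  by rewrite orderXdiv orderE -defA ?dvdn_div // divnA // mulKn ?cardG_gt0.
rewrite -(cards1 <<[set c; r]>>%G); apply: eq_card => H; rewrite !inE.
apply/idP/eqP => [/andP[/andP[nHA /eqP oH] rH] | ->].
  apply: (@reflection_eq _ _ r) => //=; last by rewrite mem_gen // !inE eqxx orbT.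
  rewrite gen_rotation_reflection //; apply/eqP.
  by rewrite (eq_subG_cyclic cycA) ?subsetIr ?cycle_subG //= oH -orderE oc.
rewrite /= gen_rotation_reflection // -orderE oc eqxx andbT.
have rK : r \in <<[set c; r]>> by rewrite mem_gen // !inE eqxx orbT.
by rewrite rK andbT; apply/subsetPn; exists r.
Qed.

Lemma card_rotation_class d : d %| #|A| ->
  #|[set H : {group gT} | H \subset A & #|H| == d]| = 1%N.
Proof.
case/cyclicP: cycA => a ->; rewrite -orderE => dvd_d.
by rewrite (cycle_sub_group dvd_d) cards1.
Qed.

End Dihedral.

(** * Generating pairs of the dihedral group of order 2p^2 *)

Section DihedralPrimeSquare.
Local Open Scope group_scope.
Variables (gT : finGroupType) (A : {group gT}) (p : nat).
Hypothesis p_pr : prime p.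
Hypothesis cycA : cyclic A.
Hypothesis oA : #|A| = (p ^ 2)%N.
Hypothesis oG : #|gT| = (2 * #|A|)%N.
Hypothesis refl2 : forall r, r \notin A -> r * r = 1.

Lemma sum_by_rotation_order (P : pred {group gT}) (F : {group gT} -> nat) :
  (\sum_(H | P H) F H =
   \sum_(j < 3) \sum_(H in [set H | P H & #|H :&: A| == p ^ j]) F H)%N.
Proof.
have ord (H : {group gT}) : exists2 i, (i < 3)%N & #|H :&: A| = (p ^ i)%N.
  have /(dvdn_pfactor _ _ p_pr)[i le_i oHA] : (#|H :&: A| %| p ^ 2)%N.
    by rewrite -oA; apply: cardSg; apply: subsetIr.
  by exists i.
rewrite (partition_big
  (fun H : {group gT} => inord (logn p #|H :&: A|) : 'I_3) predT) //=.
apply: eq_bigr => j _; apply: eq_bigl => H; rewrite inE; congr (_ && _).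
have [i lt_i ->] := ord H; rewrite pfactorK // -val_eqE /= inordK //.
by rewrite eqn_exp2l // prime_gt1.
Qed.

(** The first three entries come from the rotation subgroups of orders [1], [p]
    and [p ^ 2], the fourth from the whole group, and the last two families from
    the subgroups of order 2 outside [A] and the dihedral subgroups of order
    [2p]. *)
Lemma gen_pairs_cards : perm_eq [seq #|gen_pairs H| | H <- enum {group gT}]
  ([:: 1; p ^ 2 - 1; p ^ 4 - p ^ 2; 3 * p ^ 4 - 3 * p ^ 3]%N
    ++ nseq (p ^ 2) 3 ++ nseq p (3 * p ^ 2 - 3 * p)%N).
Proof.
have p_gt0 := prime_gt0 p_pr.
have dvd_j (j : 'I_3) : (p ^ j %| #|A|)%N by rewrite oA dvdn_exp2l // -ltnS.
have cyclic_part (F : nat -> nat) :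
    (\sum_(H : {group gT} | H \subset A) F #|gen_pairs H| =
     F 1 + (F (p ^ 2 - 1) + F (p ^ 4 - p ^ 2)))%N.
  rewrite sum_by_rotation_order.
  have term (j : 'I_3) v :
      (forall H : {group gT}, H \subset A -> #|H| = p ^ j -> #|gen_pairs H| = v)%N ->
      (\sum_(H in [set H : {group gT} | (H \subset A) & #|H :&: A| == p ^ j])
         F #|gen_pairs H| = F v)%N.
    move=> card_v; rewrite (eq_bigr (fun=> F v)) => [|H].
      rewrite sum_nat_const -[RHS]mul1n.
      rewrite -[X in _ = (X * _)%N](card_rotation_class cycA (dvd_j j)).
      congr (_ * _)%N; apply: eq_card => H; rewrite !inE.
      by case: (boolP (H \subset A)) => //= /setIidPl->.
    by rewrite inE => /andP[sHA]; rewrite (setIidPl sHA) => /eqP/card_v->.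
  have sub k : (k <= 2)%N -> exists M : {group gT}, M \subset A /\ #|M| = (p ^ k)%N.
    move=> le_k; have /card_gt0P[M] :
        (0 < #|[set M : {group gT} | M \subset A & #|M| == p ^ k]|)%N.
      by rewrite (card_rotation_class cycA) // oA dvdn_exp2l.
    by rewrite inE => /andP[sMA /eqP oM]; exists M.
  rewrite !big_ord_recl big_ord0 addn0.
  congr (_ + (_ + _))%N; apply: term => H sHA oH.
  - by have -> : H = 1%G; [apply/val_inj/card1_trivg | apply: card_gen_pairs1].
  - have [M [sMA oM]] := sub 0%N isT.
    exact: (card_gen_pairs_cyclic p_pr cycA sHA sMA oH oM).
  - have [M [sMA oM]] := sub 1%N isT.
    exact: (card_gen_pairs_cyclic p_pr cycA sHA sMA oH oM).
have dihedral_part (F : nat -> nat) :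
    (\sum_(H : {group gT} | ~~ (H \subset A)) F #|gen_pairs H| =
     p ^ 2 * F 3 + (p * F (3 * p ^ 2 - 3 * p) + F (3 * p ^ 4 - 3 * p ^ 3)))%N.
  rewrite sum_by_rotation_order.
  have term (j : 'I_3) v : (3 * (p ^ j * totient (p ^ j)) = v)%N ->
      (\sum_(H in [set H : {group gT} | ~~ (H \subset A) & #|H :&: A| == p ^ j])
         F #|gen_pairs H| = p ^ (2 - j) * F v)%N.
    move=> card_v; rewrite (eq_bigr (fun=> F v)) => [|H]; last first.
      rewrite inE => /andP[nHA /eqP oHA].
      by rewrite (card_gen_pairs_reflection cycA oG refl2 nHA) oHA card_v.
    rewrite sum_nat_const; congr (_ * _)%N; apply/eqP.
    have pj_gt0 : (0 < p ^ j)%N by rewrite expn_gt0 p_gt0.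
    rewrite -(eqn_pmul2r pj_gt0) (card_reflection_class cycA oG refl2 (dvd_j j)).
    by rewrite oA -expnD subnK // -ltnS.
  rewrite !big_ord_recl big_ord0 addn0.
  (* The exponents [2 - j] in [term] are displayed for [j = 0, 1, 2]. *)
  have -> : (p ^ 2 * F 3 + (p * F (3 * p ^ 2 - 3 * p) + F (3 * p ^ 4 - 3 * p ^ 3)) =
    p ^ (2 - 0) * F 3 + (p ^ (2 - 1) * F (3 * p ^ 2 - 3 * p)
      + p ^ (2 - 2) * F (3 * p ^ 4 - 3 * p ^ 3)))%N
    by rewrite subn0 subSnn subnn expn1 expn0 mul1n.
  congr (_ + (_ + _))%N; apply: term => //=; rewrite totient_pfactor //=; clear -p_gt0.
    case: p p_gt0 => // q _; rewrite /= !expnS; nia.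
  case: p p_gt0 => // q _; rewrite /= !expnS; nia.
(* Multiplicities are compared through sums of indicators over all subgroups, to
   which the two partial sums apply. *)
apply/seq.permP => a; rewrite !count_cat !count_nseq /= count_map -sum1_count.
rewrite big_enum_cond /= big_mkcond /=.
rewrite (bigID (fun H : {group gT} => H \subset A)) /=.
rewrite (cyclic_part (fun n => if a n then 1 else 0)%N).
rewrite (dihedral_part (fun n => if a n then 1 else 0)%N).
have ifE b : (if b then 1 else 0)%N = b :> nat by case: b.
rewrite !ifE; ring.
Qed.

End DihedralPrimeSquare.

(** * The rotation subgroup of a presented dihedral group *)

Section DihedralPresentation.
Local Open Scope group_scope.

(** The relations bound the order of the group by [2m].  Conversely the concrete
    dihedral group ['D_m.*2] satisfies them, hence is a quotient of the
    presented group, whose order is therefore at least [2m].  Equality forces [a] and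
    [b] to have orders [m] and [2]. *)
Lemma dihedral_presentation m (gT : finGroupType) :
    (1 < m)%N -> is_dihedral m gT ->
  exists A : {group gT}, [/\ cyclic A, #|A| = m, #|gT| = (2 * m)%N
    & forall r, r \notin A -> r * r = 1].
Proof.
move=> m_gt1 dihG.
have sq1V (hT : finGroupType) (z : hT) : z ^+ 2 = 1 -> z^-1 = z.
  by rewrite expgS expg1 => zz; apply/eqP; rewrite eq_invg_mul zz.
have /existsP[[a b] /=] := isoGrp_hom dihG.
rewrite !xpair_eqE => /and4P[/eqP defG /eqP am /eqP b2 /eqP bab].
have oG_ge : (m * 2 <= #|gT|)%N.
  have homD : [set: 'D_m.*2] \homg [set: gT].
    rewrite dihG; have /existsP[[x y] /=] := isoGrp_hom (Grp_dihedral m_gt1).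
    rewrite !xpair_eqE => /and4P[/eqP defD /eqP xm /eqP y2 /eqP xy].
    apply/existsP; exists (x, y); rewrite /= !xpair_eqE defD xm y2 !eqxx /=.
    by rewrite -xy /conjg sq1V // mulgA.
  have := card_homg homD; rewrite card_dihedral // cardsT muln2.
  by apply: dvdn_leq; apply/card_gt0P; exists 1.
have aJb : a ^ b = a^-1 by rewrite -bab /conjg sq1V // mulgA.
have defAB : <[a]> * <[b]> = [set: gT].
  by rewrite -norm_joinEr // cycle_subG inE -cycleJ aJb cycleV.
have oa_le : (#[a] <= m)%N by rewrite dvdn_leq ?(ltnW m_gt1) // order_dvdn am.
have ob_le : (#[b] <= 2)%N by rewrite dvdn_leq // order_dvdn b2.
have oG_le : (#|gT| <= #[a] * #[b])%N.
  by rewrite -cardsT -defAB !orderE mul_cardG leq_pmulr ?cardG_gt0.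
have [oa ob] : #[a] = m /\ #[b] = 2.
  by split; apply/eqP; rewrite eqn_leq ?oa_le ?ob_le /=; nia.
exists <[a]>%G; split; first exact: cycle_cyclic.
- exact: oa.
- by apply/eqP; rewrite eqn_leq mulnC oG_ge (leq_trans oG_le) // oa ob.
move=> r rA; have: r \in <[a]> * <[b]> by rewrite defAB inE.
case/mulsgP => u v uA; rewrite /= cycle2g // !inE => /orP[] /eqP -> def_r.
  by case/negP: rA; rewrite def_r mulg1.
have uJb : u ^ b = u^-1.
  by have /cycleP[i ->] := uA; rewrite conjXg aJb expgVn.
rewrite def_r -mulgA (mulgA b) -{1}(sq1V _ b b2) -[_ * b]mulgA.
by rewrite -/(conjg u b) uJb mulgV.
Qed.

End DihedralPresentation.

(** * Determinants of star block matrices *)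

Local Open Scope ring_scope.

Lemma det_reindex (R : comNzRingType) m n (h : 'I_m -> 'I_n) (A : 'M[R]_n) :
  bijective h -> \det (\matrix_(i, j) A (h i) (h j)) = \det A.
Proof.
move=> h_bij; have mn : m = n by have:= bij_eq_card h_bij; rewrite !card_ord.
subst m; pose s := perm (bij_inj h_bij).
have -> : \matrix_(i, j) A (h i) (h j) = row_perm s (col_perm s A).
  by apply/matrixP => i j; rewrite !mxE !permE.
rewrite row_permE col_permE !det_mulmx !det_perm odd_permV mulrCA.
by rewrite -signr_addb addbb mulr1.
Qed.

Section SumIndexed.
Variables (R : comNzRingType) (T U : finType).

Let sum_ord (i : 'I_#|{: T + U}|) : 'I_(#|T| + #|U|) :=
  match enum_val i with
  | inl t => lshift _ (enum_rank t)
  | inr u => rshift _ (enum_rank u)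
  end.

Let sum_ord_bij : bijective sum_ord.
Proof.
exists (fun k => enum_rank (match split k with
  | inl i => inl (enum_val i) | inr j => inr (enum_val j) end)) => k.
  rewrite /sum_ord; case E: (enum_val k) => [t|u].
    by rewrite (unsplitK (inl _)) enum_rankK -E enum_valK.
  by rewrite (unsplitK (inr _)) enum_rankK -E enum_valK.
by rewrite /sum_ord enum_rankK; case: splitP => j E; rewrite enum_valK;
  apply: val_inj; rewrite /= E.
Qed.

(** Graph matrices are indexed by an enumeration of the vertices; for vertices in
    a sum type, this recovers the block decomposition. *)
Lemma det_sum_blocks (F : T + U -> T + U -> R) :
  \det (\matrix_(i < #|{: T + U}|, j < #|{: T + U}|)
          F (enum_val i) (enum_val j)) =
  \det (block_mx
    (\matrix_(i < #|T|, j < #|T|) F (inl (enum_val i)) (inl (enum_val j)))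
    (\matrix_(i < #|T|, j < #|U|) F (inl (enum_val i)) (inr (enum_val j)))
    (\matrix_(i < #|U|, j < #|T|) F (inr (enum_val i)) (inl (enum_val j)))
    (\matrix_(i < #|U|, j < #|U|) F (inr (enum_val i)) (inr (enum_val j)))).
Proof.
rewrite -(det_reindex _ sum_ord_bij); congr (\det _).
apply/matrixP => i j; rewrite [LHS]mxE [RHS]mxE /sum_ord.
by case: (enum_val i) => x; case: (enum_val j) => y;
  rewrite ?block_mxEul ?block_mxEur ?block_mxEdl ?block_mxEdr mxE !enum_rankK.
Qed.

End SumIndexed.

(** Multiplying on the right by [block_mx 1 (- c *: B) 0 y], whose determinant
    is [y ^+ #|U|], clears the upper right block; as [c * c = 1] and [B^T *m B]
    is diagonal with the fiber sizes of [f] as entries, the lower right block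
    becomes [y * diag w - B^T *m B]. *)
Lemma det_star_blocks (R : comNzRingType) (T U : finType) (f : T -> U)
    (c y : R) (w : U -> R) (B := \matrix_(i < #|T|, j < #|U|)
       (f (enum_val i) == enum_val j)%:R : 'M[R]_(#|T|, #|U|)) :
  c * c = 1 ->
  \det (block_mx y%:M (c *: B) (c *: B^T) (diag_mx (\row_j w (enum_val j))))
     * y ^+ #|U|
  = y ^+ #|T| * \prod_u (y * w u - #|[set t | f t == u]|%:R).
Proof.
move=> c2.
have BtB : B^T *m B = diag_mx (\row_j #|[set t | f t == enum_val j]|%:R).
  apply/matrixP => i j; rewrite !mxE.
  under eq_bigr => k _ do rewrite !mxE -natrM mulnb.
  rewrite -natr_sum -mulrnA; congr (_%:R).
  rewrite -(big_enum_val (A := T) (fun t => nat_of_bool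
     ((f t == enum_val i) && (f t == enum_val j)))) /=.
  case: eqVneq => [->|ne]; last first.
    rewrite muln0 big1 // => t _; case: eqP => //= ->.
    by rewrite (inj_eq enum_val_inj) (negPf ne).
  rewrite muln1 -sum1dep_card [RHS]big_mkcond /=.
  by apply: eq_bigr => t _; rewrite andbb; case: ifP.
have <- : \det (block_mx 1%:M (- c *: B) 0 y%:M) = y ^+ #|U|.
  by rewrite det_ublock det1 mul1r det_scalar.
rewrite -det_mulmx mulmx_block.
rewrite !mulmx1 !mulmx0 !addr0.
rewrite !mul_mx_scalar mul_scalar_mx -!scalemxAl -!scalemxAr BtB.
rewrite -scalerDr -scalerDl addNr scale0r scaler0 det_lblock det_scalar.
have -> : c *: (- c *: diag_mx (\row_j #|[set t | f t == enum_val j]|%:R)) +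
    y *: diag_mx (\row_j w (enum_val j)) =
    diag_mx (\row_j (y * w (enum_val j) - #|[set t | f t == enum_val j]|%:R))
    :> 'M[R]_#|U|.
  apply/matrixP => i j; rewrite !mxE mulrA mulrN c2 mulN1r mulrnAr -mulNrn.
  by rewrite -mulrnDl addrC.
rewrite det_diag; under eq_bigr => j _ do rewrite mxE.
by rewrite (big_enum_val (A := U)
  (fun u => y * w u - #|[set t | f t == u]|%:R)).
Qed.

(** * Spectra of star forests *)

(** The cofactor [s1] makes it possible to identify the eigenvalues from an
    identity in which the characteristic polynomial comes with an extra factor,
    without dividing polynomials. *)
Lemma eigenvalues_perm (C : numClosedFieldType) n (A : 'M[C]_n) (s1 s2 : seq C) :
    char_poly A * \prod_(z <- s1) ('X - z%:P) = \prod_(z <- s2) ('X - z%:P) ->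
  perm_eq (eigenvalues A ++ s1) s2.
Proof.
rewrite /eigenvalues; case: closed_field_poly_normal => r /= ->.
rewrite (monicP (char_poly_monic A)) scale1r -big_cat /=.
exact: prod_XsubC_eq.
Qed.

Lemma count_tally_seq (T : eqType) (a : pred T) (bs : seq (T * nat)) :
  count a (tally_seq bs) = sumn [seq (a b.1 * b.2)%N | b <- bs].
Proof.
by elim: bs => //= -[x n] bs IHbs; rewrite count_cat count_nseq IHbs.
Qed.

(** A graph on [T + U] in which each [t : T] is a leaf attached to the center
    [f t], so that the star of [u] has [fib u] leaves. *)
Section StarForest.
Variables (C : numClosedFieldType) (T U : finType) (f : T -> U).
Variables (e : rel (T + U)) (e_sym : symmetric e) (e_irr : irreflexive e).
Hypothesis e_ll : forall t t', e (inl t) (inl t') = false.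
Hypothesis e_lr : forall t u, e (inl t) (inr u) = (f t == u).
Hypothesis e_rr : forall u u', e (inr u) (inr u') = false.

Let Gamma := SGraph e_sym e_irr.
Let fib u := #|[set t | f t == u]|.

Let e_rl t u : e (inr u) (inl t) = (f t == u). Proof. by rewrite e_sym. Qed.

(** The common shape of the adjacency, Laplacian and signless Laplacian
    matrices, for [(a, c, w) = (0, 1, 0)], [(1, -1, fib)] and [(1, 1, fib)]. *)
Definition star_entry (a c : C) (w : U -> C) (x y : T + U) : C :=
  match x, y with
  | inl t, inl t' => a *+ (t == t')
  | inl t, inr u | inr u, inl t => c *+ (f t == u)
  | inr u, inr u' => w u *+ (u == u')
  end.

Lemma char_poly_star (A : 'M[C]_#|{: T + U}|) (a c : C) (w : U -> C) :
    c * c = 1 ->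
    (forall i j, A i j = star_entry a c w (enum_val i) (enum_val j)) ->
  char_poly A * ('X - a%:P) ^+ #|U| =
  ('X - a%:P) ^+ #|T| *
    \prod_u (('X - a%:P) * ('X - (w u)%:P) - (fib u)%:R).
Proof.
move=> c2 defA; rewrite /char_poly.
pose F (x y : T + U) : {poly C} := 'X *+ (x == y) - (star_entry a c w x y)%:P.
have -> : char_poly_mx A = \matrix_(i, j) F (enum_val i) (enum_val j).
  apply/matrixP => i j; rewrite !mxE defA /F; congr (_ *+ _ - _).
  by rewrite (inj_eq enum_val_inj).
rewrite det_sum_blocks -(@det_star_blocks _ _ _ _ (- c%:P)); last first.
  by rewrite mulrNN -polyCM c2.
congr (\det (block_mx _ _ _ _) * _); apply/matrixP => i j;
  rewrite !mxE /F /star_entry //=.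
- rewrite (inj_eq (@inl_inj _ _)) (inj_eq enum_val_inj) polyCMn.
  by rewrite -mulNrn -mulrnDl.
- by rewrite mulr0n sub0r polyCMn mulNr mulr_natr.
- by rewrite mulr0n sub0r polyCMn mulNr mulr_natr.
- rewrite (inj_eq (@inr_inj _ _)) (inj_eq enum_val_inj) polyCMn.
  by rewrite -mulNrn -mulrnDl.
Qed.

(** Two leaves have a common neighbor exactly when they share their center, so
    the leaf block is [B *m B^T - 1] with [B] the incidence matrix.  The
    determinant of [X + 1 - B *m B^T] is that of the star block matrix with
    [y = X + 1] and [w = 1], by the Schur complement of its other diagonal
    block. *)
Lemma char_poly_star_cn (A : 'M[C]_#|{: T + U}|) :
    (forall i j, A i j = match enum_val i, enum_val j with
       | inl t, inl t' => (f t == f t')%:R - (t == t')%:R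
       | _, _ => 0
       end) ->
  char_poly A * ('X + 1) ^+ #|U| =
  'X ^+ #|U| * (('X + 1) ^+ #|T| * \prod_u ('X + 1 - (fib u)%:R)).
Proof.
move=> defA; rewrite /char_poly.
pose F (x y : T + U) : {poly C} := 'X *+ (x == y) - (match x, y with
       | inl t, inl t' => (f t == f t')%:R - (t == t')%:R
       | _, _ => 0
       end)%:P.
have -> : char_poly_mx A = \matrix_(i, j) F (enum_val i) (enum_val j).
  apply/matrixP => i j; rewrite !mxE defA /F; congr (_ *+ _ - _).
  by rewrite (inj_eq enum_val_inj).
rewrite det_sum_blocks.
pose B := \matrix_(i < #|T|, j < #|U|)
       (f (enum_val i) == enum_val j)%:R : 'M[{poly C}]_(#|T|, #|U|).
have -> : \matrix_(i, j) F (inl (enum_val i)) (inr (enum_val j)) = 0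
    :> 'M_(#|T|, #|U|).
  by apply/matrixP => i j; rewrite !mxE /F mulr0n subr0.
rewrite det_lblock.
have -> : \matrix_(i, j) F (inr (enum_val i)) (inr (enum_val j)) = 'X%:M
    :> 'M_#|U|.
  apply/matrixP => i j; rewrite !mxE /F subr0.
  by rewrite (inj_eq (@inr_inj _ _)) (inj_eq enum_val_inj).
rewrite det_scalar -mulrA mulrCA; congr (_ * _).
have -> : \matrix_(i, j) F (inl (enum_val i)) (inl (enum_val j)) =
    ('X + 1)%:M - B *m B^T :> 'M_#|T|.
  apply/matrixP => i j; rewrite !mxE /F.
  rewrite (inj_eq (@inl_inj _ _)) (inj_eq enum_val_inj).
  under eq_bigr => k _ do rewrite !mxE -natrM mulnb.
  rewrite -(big_enum_val (A := U) (fun u => (((f (enum_val i) == u)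
     && (f (enum_val j) == u)))%:R)) /=.
  rewrite (bigD1 (f (enum_val i))) //= eqxx big1 ?addr0 => [|u ne]; last first.
    by rewrite eq_sym (negPf ne).
  rewrite [_ == f (enum_val i)]eq_sym polyCB mulrnDl opprB addrA; congr (_ - _).
    by rewrite polyC_natr addrC.
  by rewrite polyC_natr.
have := @det_star_blocks _ _ _ f 1 ('X + 1 : {poly C}) (fun=> 1) (mulr1 1).
rewrite -/B !scale1r.
have -> : diag_mx (\row_(j < #|U|) 1) = 1%:M :> 'M[{poly C}]_#|U|.
  by apply/matrixP => i j; rewrite !mxE.
under eq_bigr => u _ do rewrite mulr1.
move=> <-; congr (_ * _).
have d1 : \det (block_mx 1%:M 0 (- B^T) 1%:M) = 1 :> {poly C}.
  by rewrite det_lblock !det1 mulr1.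
rewrite -[RHS]mulr1 -[X in _ = _ * X]d1.
rewrite -det_mulmx mulmx_block.
rewrite !mulmx1 !mulmx0 !mul1mx !add0r subrr mulmxN.
by rewrite det_ublock det1 mulr1.
Qed.

Lemma star_deg_leaf t : deg (inl t : Gamma) = 1%N.
Proof.
rewrite /deg -(cards1 (inr (f t) : T + U)); apply: eq_card => -[t'|u].
  by rewrite !inE /= e_ll.
by rewrite !inE /= e_lr eq_sym.
Qed.

Lemma star_deg_center u : deg (inr u : Gamma) = fib u.
Proof.
rewrite /deg /fib -(card_imset _ (@inl_inj T U)); apply: eq_card => -[t|u'].
  by rewrite !inE /= e_rl mem_imset ?inE //; apply: inl_inj.
by rewrite !inE /= e_rr; apply/esym/imsetP => -[].
Qed.

Lemma star_common_neighbors_leaf (t t' : T) : t != t' ->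
  #|common_neighbors (inl t : Gamma) (inl t' : Gamma)| = (f t == f t').
Proof.
move=> tt'; transitivity #|[set (inr u : T + U) |
    u in [set u | (f t == u) && (f t' == u)]]|.
  apply: eq_card => -[s|u]; rewrite !inE /=.
    by rewrite !e_ll !andbF; apply/esym/imsetP => -[].
  by rewrite !e_lr mem_imset ?inE //; apply: inr_inj.
rewrite card_imset; last exact: inr_inj.
case: (f t =P f t') => [<-|ne]; last first.
  by apply/eqP; rewrite cards_eq0; apply/eqP/setP=> u; rewrite !inE;
     apply/andP => -[/eqP E /eqP E']; case: ne; rewrite E E'.
by rewrite -[RHS](cards1 (f t)); apply: eq_card => u; rewrite !inE andbb eq_sym.
Qed.

Lemma star_common_neighbors_center (v : Gamma) (u : U) : v != inr u ->
  (#|common_neighbors v (inr u : Gamma)| = 0)%N *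
  (#|common_neighbors (inr u : Gamma) v| = 0)%N.
Proof.
move=> ne; have no_cn x : e v x && e (inr u) x = false.
  move: v ne x => [t|u'] ne [t'|u'']; rewrite ?e_ll ?e_rr ?andbF // !e_rl.
  by apply/andP => -[/eqP E /eqP E']; rewrite -E E' eqxx in ne.
by split; apply/eqP; rewrite cards_eq0; apply/eqP/setP => x; rewrite !inE /=;
  have:= no_cn x; case: (e v x); case: (e _ x); rewrite ?andbF.
Qed.

Variable ns : seq nat.
Hypothesis ns_fib : perm_eq [seq fib u | u <- enum U] ns.

Let card_ns : size ns = #|U|.
Proof. by rewrite -(perm_size ns_fib) size_map cardE. Qed.

Let prod_fib (F : nat -> {poly C}) : \prod_u F (fib u) = \prod_(n <- ns) F n.
Proof. by rewrite -(perm_big _ ns_fib) big_map big_enum. Qed.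

Let prod_nseq n (z : C) :
  \prod_(x <- nseq n z) ('X - x%:P) = ('X - z%:P) ^+ n.
Proof. by rewrite big_nseq iter_mulr_1. Qed.

(** The star with [n] leaves contributes [X ^ 2 - n]; the surplus
    [nseq #|U| 0] is the factor [y ^ #|U|] of [char_poly_star]. *)
Lemma star_spec :
  perm_eq (spec C Gamma ++ nseq #|U| 0)
    (nseq #|T| 0 ++ [seq sqrtC n%:R | n <- ns] ++ [seq - sqrtC n%:R | n <- ns]).
Proof.
apply: eigenvalues_perm; rewrite !big_cat !prod_nseq /=.
rewrite (@char_poly_star _ 0 1 (fun=> 0)) ?mulr1 // => [|i j]; last first.
  rewrite mxE /star_entry /=; case: (enum_val i) => x; case: (enum_val j) => y;
  by rewrite ?e_ll ?e_lr ?e_rl ?e_rr ?mul0rn.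
congr (_ * _); rewrite (prod_fib (fun n => ('X - 0%:P) * ('X - 0%:P) - n%:R)).
rewrite !big_map -big_split; apply: eq_bigr => n _ /=.
rewrite polyCN opprK subr0 -[n%:R in LHS]polyC_natr -[n%:R in LHS]sqrtCK polyC_exp.
by rewrite -subr_sqr expr2.
Qed.

(* The signs of the off-diagonal blocks cancel in [char_poly_star], so the
   Laplacian and the signless Laplacian share this factor. *)
Let laplacian_factor n :
  ('X - 1%:P) * ('X - n%:R%:P) - n%:R = ('X - 0%:P) * ('X - n.+1%:R%:P) :> {poly C}.
Proof. by rewrite !polyC_natr polyC0 -(natr1 n); ring. Qed.

Lemma star_L_spec :
  perm_eq (L_spec C Gamma ++ nseq #|U| 1)
    (nseq #|T| 1 ++ nseq #|U| 0 ++ [seq n.+1%:R | n <- ns]).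
Proof.
apply: eigenvalues_perm; rewrite !big_cat !prod_nseq /=.
rewrite (@char_poly_star _ 1 (-1) (fun u => (fib u)%:R)) ?mulrNN ?mulr1 //
  => [|i j]; last first.
  rewrite !mxE -(inj_eq enum_val_inj) /star_entry.
  case: (enum_val i) => x; case: (enum_val j) => y;
    rewrite ?star_deg_leaf ?star_deg_center /= ?e_ll ?e_lr ?e_rl
      ?e_rr ?sub0r ?subr0 ?mulr0n //.
  - by rewrite mulNrn.
  - by rewrite mulNrn.
congr (_ * _); rewrite (prod_fib (fun n => ('X - 1%:P) * ('X - n%:R%:P) - n%:R)).
rewrite big_map (eq_bigr _ (fun n _ => laplacian_factor n)) big_split /=.
by rewrite big_const_seq count_predT iter_mulr_1 card_ns.
Qed.

Lemma star_Q_spec :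
  perm_eq (Q_spec C Gamma ++ nseq #|U| 1)
    (nseq #|T| 1 ++ nseq #|U| 0 ++ [seq n.+1%:R | n <- ns]).
Proof.
apply: eigenvalues_perm; rewrite !big_cat !prod_nseq /=.
rewrite (@char_poly_star _ 1 1 (fun u => (fib u)%:R)) ?mulr1 //
  => [|i j]; last first.
  rewrite !mxE -(inj_eq enum_val_inj) /star_entry.
  case: (enum_val i) => x; case: (enum_val j) => y;
    rewrite ?star_deg_leaf ?star_deg_center /= ?e_ll ?e_lr ?e_rl
      ?e_rr ?add0r ?addr0 ?mulr0n //.
congr (_ * _); rewrite (prod_fib (fun n => ('X - 1%:P) * ('X - n%:R%:P) - n%:R)).
rewrite big_map (eq_bigr _ (fun n _ => laplacian_factor n)) big_split /=.
by rewrite big_const_seq count_predT iter_mulr_1 card_ns.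
Qed.

(** The centers are isolated in the common neighborhood matrix and the [n]
    leaves of a star form a complete graph. *)
Lemma star_CN_spec :
  perm_eq (CN_spec C Gamma ++ nseq #|U| (-1))
    (nseq #|U| 0 ++ nseq #|T| (-1) ++ [seq n%:R - 1 | n <- ns]).
Proof.
apply: eigenvalues_perm; rewrite !big_cat !prod_nseq /=.
rewrite polyCN opprK subr0 char_poly_star_cn => [|i j]; last first.
  rewrite mxE -(inj_eq enum_val_inj).
  case: eqP.
    by move=> ->; case: (enum_val j) => // x; rewrite !eqxx subrr.
  case: (enum_val i) => x; case: (enum_val j) => y ne;
    rewrite ?star_common_neighbors_center //; try exact/eqP.
  have xy : x != y by apply: contra_notN ne => /eqP->.
  by rewrite star_common_neighbors_leaf // (negPf xy) subr0.
congr (_ * (_ * _)); rewrite (prod_fib (fun n => 'X + 1 - n%:R)).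
rewrite big_map; apply: eq_bigr => n _.
by rewrite polyCB polyC_natr opprB addrA.
Qed.

End StarForest.

(** * The spectra for the dihedral group of order 2p^2 *)

Theorem theorem3p2 (C : numClosedFieldType) (p : nat) (gT : finGroupType)
    (p_prime : prime p) (dihG : is_dihedral (p ^ 2) gT) :
  let P : C := p%:R in
  let A_eigs : seq (C * nat) :=
    [:: (0, (4 * p ^ 4 - p ^ 2 - p - 4)%N);
        (-1, 1%N);
        (1, 1%N);
        (sqrtC 3, (p ^ 2)%N);
        (- sqrtC 3, (p ^ 2)%N);
        (sqrtC (P ^+ 2 - 1), 1%N);
        (- sqrtC (P ^+ 2 - 1), 1%N);
        (sqrtC (P ^+ 4 - P ^+ 2), 1%N);
        (- sqrtC (P ^+ 4 - P ^+ 2), 1%N);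
        (sqrtC (3 * P ^+ 2 - 3 * P), p);
        (- sqrtC (3 * P ^+ 2 - 3 * P), p);
        (sqrtC (3 * P ^+ 4 - 3 * P ^+ 3), 1%N);
        (- sqrtC (3 * P ^+ 4 - 3 * P ^+ 3), 1%N)] in
  let L_eigs : seq (C * nat) :=
    [:: (0, (p ^ 2 + p + 4)%N);
        (1, (4 * p ^ 4 - p ^ 2 - p - 4)%N);
        (2, 1%N);
        (4, (p ^ 2)%N);
        (P ^+ 2, 1%N);
        (P ^+ 4 - P ^+ 2 + 1, 1%N);
        (3 * P ^+ 2 - 3 * P + 1, p);
        (3 * P ^+ 4 - 3 * P ^+ 3 + 1, 1%N)] in
  let CN_eigs : seq (C * nat) :=
    [:: (0, (p ^ 2 + p + 5)%N);
        (-1, (4 * p ^ 4 - p ^ 2 - p - 4)%N);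
        (2, (p ^ 2)%N);
        (P ^+ 2 - 2, 1%N);
        (P ^+ 4 - P ^+ 2 - 1, 1%N);
        (3 * P ^+ 2 - 3 * P - 1, p);
        (3 * P ^+ 4 - 3 * P ^+ 3 - 1, 1%N)] in
  [/\ perm_eq (spec C (sgb_graph gT)) (tally_seq A_eigs),
      perm_eq (L_spec C (sgb_graph gT)) (tally_seq L_eigs),
      perm_eq (Q_spec C (sgb_graph gT)) (tally_seq L_eigs)
    & perm_eq (CN_spec C (sgb_graph gT)) (tally_seq CN_eigs)].
Proof.
move=> P A_eigs L_eigs CN_eigs.
have p_gt1 := prime_gt1 p_prime.
have [|A [cycA oA oG refl2]] := dihedral_presentation _ dihG.
  by rewrite -(expn0 p) ltn_exp2l.
rewrite -oA in oG; have cards := gen_pairs_cards p_prime cycA oA oG refl2.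
set ns := (_ ++ _) in cards.
pose f (xy : gT * gT) := <<[set xy.1; xy.2]>>%G.
have e_ll t t' : @sgb_edge gT (inl t) (inl t') = false.
  by case: t => ? ?; case: t'.
have e_lr t H : @sgb_edge gT (inl t) (inr H) = (f t == H) by case: t.
have e_rr H K : @sgb_edge gT (inr H) (inr K) = false by [].
have oU : #|{group gT}| = (p ^ 2 + p + 4)%N.
  rewrite cardE -(size_map (fun H => #|gen_pairs H|)) (perm_size cards).
  by rewrite !size_cat !size_nseq /= addnC.
have nsE : [seq n%:R | n <- ns] =
    [:: 1; P ^+ 2 - 1; P ^+ 4 - P ^+ 2; 3 * P ^+ 4 - 3 * P ^+ 3]
    ++ nseq (p ^ 2) 3 ++ nseq p (3 * P ^+ 2 - 3 * P) :> seq C.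
  rewrite /ns !map_cat !map_nseq /=.
  have le_pX i j : (i <= j -> p ^ i <= p ^ j)%N by apply/leq_pexp2l/ltnW.
  have le_3pX i j : (i <= j -> 3 * p ^ i <= 3 * p ^ j)%N.
    by rewrite leq_mul2l; apply: le_pX.
  by rewrite !natrB ?natrM ?natrX ?(le_pX 0) ?le_pX ?le_3pX ?(le_3pX 1).
(* [K] is a truncated difference: [oT] shows that no truncation occurs. *)
set K := (4 * p ^ 4 - p ^ 2 - p - 4)%N in A_eigs L_eigs CN_eigs *.
have oT : #|{: gT * gT}| = (K + #|{group gT}|)%N.
  have le_p : (p <= p ^ 2 <= p ^ 4)%N by rewrite -{1}(expn1 p) !leq_exp2l.
  have p4 : (2 ^ 4 <= p ^ 4)%N by rewrite leq_exp2r.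
  rewrite card_prod oG oA oU /K (_ : p ^ 4 = p ^ 2 * p ^ 2)%N -?expnD //.
  rewrite (_ : 2 * p ^ 2 * (2 * p ^ 2) = 4 * p ^ 4)%N; first by lia.
  by rewrite mulnACA -expnD.
have map_ns (g : C -> C) : [seq g n%:R | n <- ns] =
    [:: g 1; g (P ^+ 2 - 1); g (P ^+ 4 - P ^+ 2);
        g (3 * P ^+ 4 - 3 * P ^+ 3)]
    ++ nseq (p ^ 2) (g 3) ++ nseq p (g (3 * P ^+ 2 - 3 * P)).
  by rewrite (map_comp g) nsE !map_cat !map_nseq.
have map_succ : [seq n.+1%:R | n <- ns] = [seq n%:R + 1 | n <- ns] :> seq C.
  by apply: eq_map => n; rewrite natr1.
have L_perm : perm_eq (nseq #|{: gT * gT}| 1 ++ nseq #|{group gT}| 0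
    ++ [seq n.+1%:R | n <- ns]) (tally_seq L_eigs ++ nseq #|{group gT}| 1).
  rewrite map_succ (map_ns (fun x => x + 1)) subrK natr1 -[1 + 1]/(2%:R).
  apply/seq.permP => a; rewrite oT oU [RHS]count_cat count_tally_seq
    /L_eigs !(count_cat, count_nseq) /=.
  ring.
split.
- rewrite -(perm_cat2r (nseq #|{group gT}| 0)).
  apply: (perm_trans (@star_spec C _ _ f _ _ _ e_ll e_lr e_rr ns cards)).
  rewrite (map_ns sqrtC) (map_ns (fun x => - sqrtC x)) sqrtC1.
  apply/seq.permP => a; rewrite oT oU [RHS]count_cat count_tally_seq
    /A_eigs !(count_cat, count_nseq) /=.
  ring.
- rewrite -(perm_cat2r (nseq #|{group gT}| 1)).
  apply: (perm_trans (@star_L_spec C _ _ f _ _ _ e_ll e_lr e_rr ns cards)).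
  exact: L_perm.
- rewrite -(perm_cat2r (nseq #|{group gT}| 1)).
  apply: (perm_trans (@star_Q_spec C _ _ f _ _ _ e_ll e_lr e_rr ns cards)).
  exact: L_perm.
rewrite -(perm_cat2r (nseq #|{group gT}| (-1))).
apply: (perm_trans (@star_CN_spec C _ _ f _ _ _ e_ll e_lr e_rr ns cards)).
rewrite (map_ns (fun x => x - 1)) subrr -[_ - 1 - 1]addrA -opprD
  -[1 + 1]/(2%:R) (_ : 3 - 1 = 2); last by ring.
apply/seq.permP => a; rewrite oT oU [RHS]count_cat count_tally_seq
  /CN_eigs !(count_cat, count_nseq) /=.
  ring.
Qed.
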